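(* Let $A\in\mathbf{C}^{n\times n}$. The nonlinear matrix equation $$X+A^{*}\overline{X}^{-1}A=I_{n}\qquad(\mathrm{a})$$ has a solution $X>0$ if and only if the nonlinear matrix equation $$I_{2n}=W+\left(A^{\lozenge}\right)^{\mathrm{T}}W^{-1}A^{\lozenge}\qquad(\mathrm{b})$$ has a solution $W>0$. Moreover, the following two statements hold. 1. If equation (a) has a solution $X>0$, then it has a maximal positive definite solution $X_{+}$. In particular, if $W_{+}$ denotes the maximal positive definite solution of equation (b), then $W_{+}=X_{+}^{\heartsuit}$, or $$X_{+}=\frac{1}{2}\begin{bmatrix}\mathrm{j}I_{n}\\ I_{n}\end{bmatrix}^{*}W_{+}\begin{bmatrix}\mathrm{j}I_{n}\\ I_{n}\end{bmatrix}.$$ 2. If $A$ is nonsingular and equation (a) has a solution $X>0$, then it has a minimal positive definite solution $X_{-}$. In particular, if $W_{-}$ denotes the minimal positive definite solution of equation (b), then $W_{-}=X_{-}^{\heartsuit}$, or $$X_{-}=\frac{1}{2}\begin{bmatrix}\mathrm{j}I_{n}\\ I_{n}\end{bmatrix}^{*}W_{-}\begin{bmatrix}\mathrm{j}I_{n}\\ I_{n}\end{bmatrix}.$$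
   Context: Notation: $\overline{M}$, $M^{\mathrm{T}}$, $M^{*}$ denote the entrywise conjugate, the transpose and the conjugate transpose of a complex matrix $M$; $\mathrm{j}=\sqrt{-1}$; $M>0$ means that $M$ is (Hermitian) positive definite, and Hermitian matrices are compared in the Loewner order. For $A=A_{1}+A_{2}\mathrm{j}\in\mathbf{C}^{n\times m}$ with $A_{1},A_{2}\in\mathbf{R}^{n\times m}$, define the real $2n\times 2m$ matrices $$A^{\heartsuit}=\begin{bmatrix}A_{1}&-A_{2}\\ A_{2}&A_{1}\end{bmatrix},\qquad A^{\lozenge}=\begin{bmatrix}A_{2}&A_{1}\\ A_{1}&-A_{2}\end{bmatrix}.$$ A maximal (respectively minimal) positive definite solution of a matrix equation is a positive definite solution $X_{+}$ (respectively $X_{-}$) such that every positive definite solution $X$ satisfies $X\le X_{+}$ (respectively $X_{-}\le X$). *)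

(* Defs.v *)
From mathcomp Require Import all_boot all_order all_algebra.
From mathcomp Require Import sesquilinear spectral complex reals.

Set Implicit Arguments.
Unset Strict Implicit.
Unset Printing Implicit Defensive.

Import Order.TTheory GRing.Theory Num.Theory.
Local Open Scope ring_scope.
Local Open Scope complex_scope.
Local Open Scope sesquilinear_scope.

Section Loewner.
Context {C : numClosedFieldType} {n : nat}.
Implicit Types (M N X : 'M[C]_n) (S : 'M[C]_n -> Prop).

(* In a numClosedFieldType, [0 < z] and [0 <= z] entail that z is real. *)
Definition posdefmx M : Prop :=
  M \is hermsymmx /\
  forall v : 'cV[C]_n, v != 0 -> 0 < (v ^t* *m M *m v) 0 0.

Definition possemidefmx M : Prop :=
  M \is hermsymmx /\
  forall v : 'cV[C]_n, 0 <= (v ^t* *m M *m v) 0 0.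

Definition loewner_le M N : Prop := possemidefmx (N - M).

Definition posdef_sol S X : Prop := posdefmx X /\ S X.

Definition maximal_posdef_sol S X : Prop :=
  posdef_sol S X /\ forall Y, posdef_sol S Y -> loewner_le Y X.

Definition minimal_posdef_sol S X : Prop :=
  posdef_sol S X /\ forall Y, posdef_sol S Y -> loewner_le X Y.

End Loewner.

Section RealRepresentation.
Context {R : rcfType}.

Definition heartmx {n m} (A : 'M[R[i]]_(n, m)) : 'M[R]_(n + n, m + m) :=
  let A1 := map_mx (@complex.Re R) A in
  let A2 := map_mx (@complex.Im R) A in
  block_mx A1 (- A2) A2 A1.

Definition lozengemx {n m} (A : 'M[R[i]]_(n, m)) : 'M[R]_(n + n, m + m) :=
  let A1 := map_mx (@complex.Re R) A in
  let A2 := map_mx (@complex.Im R) A in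
  block_mx A2 A1 A1 (- A2).

Definition mx_complex {n m} (A : 'M[R]_(n, m)) : 'M[R[i]]_(n, m) :=
  map_mx (real_complex R) A.

Definition eq_a {n} (A X : 'M[R[i]]_n) : Prop :=
  X + A ^t* *m invmx (map_mx Num.conj X) *m A = 1%:M.

(* The coefficients are real, but the unknown W is a complex matrix, so that
   "W > 0" means Hermitian positive definite in both equations. *)
Definition eq_b {n} (A : 'M[R[i]]_n) (W : 'M[R[i]]_(n + n)) : Prop :=
  let L := mx_complex (lozengemx A) in
  1%:M = W + L^T *m invmx W *m L.

(* The 2n x n matrix with blocks j I_n (top) and I_n (bottom);
   ['i%C] is the complex number [0 +i* 1]. *)
Definition jcolmx n : 'M[R[i]]_(n + n, n) := col_mx ('i%C)%:M 1%:M.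

End RealRepresentation.

(* Main.v *)
Require Import Defs.
From mathcomp Require Import all_boot all_order all_algebra.
From mathcomp Require Import sesquilinear spectral complex reals.
From mathcomp Require Import boolp topology normedtype sequences.
From mathcomp Require Import ring.
Import Order.TTheory GRing.Theory Num.Theory.
Import numFieldNormedType.Exports.
Local Open Scope ring_scope.
Local Open Scope sesquilinear_scope.

(** Equation (b) does not change when it is conjugated entrywise, because its
    coefficient [L = mx_complex (lozengemx A)] is real, nor when it is congruent
    by a certain Hermitian unitary involution [jflip] that anticommutes with
    [L], because [L] occurs in it twice. Both operations are involutions that
    preserve positive definiteness and the Loewner order, so they permute the
    solutions and must fix an extremal one, which is unique. The matrices fixed by both are exactly the [heartmx X], and
    [heartmx X] solves (b) precisely when [X] solves (a). So every extremal
    solution of (b) comes from an extremal solution of (a), and it remains to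
    produce extremal solutions of (b) only ([maximal_heart], [minimal_heart]).

    The unitary matrix [jbasis], whose block columns are [jcolmx n] and its
    conjugate up to a scalar, makes all this visible: in that basis [heartmx X]
    becomes the block diagonal matrix with blocks [X] and its conjugate
    ([heart_diag]), [L] becomes block antidiagonal ([lozenge_anti]) and [jflip]
    becomes the signature [(1, -1)].

    A maximal solution of [W + B^* W^-1 B = 1], for any square [B], is the limit
    of the iteration [W := 1 - B^* W^-1 B] started at [1]: the iterates decrease
    and remain above every solution ([nme_maximal]). When [B] is invertible,
    [W] solves the equation for [B] exactly when [1 - W] solves it for [B^*], so
    a maximal solution of the latter gives a minimal solution of the former
    ([nme_minimal]). *)

Set Implicit Arguments.
Unset Strict Implicit.
Unset Printing Implicit Defensive.

(** * Adjoints and polarization *)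

Section Adjoint.
Context {C : numClosedFieldType}.

Lemma adjM m n p (A : 'M[C]_(m, n)) (B : 'M[C]_(n, p)) :
  (A *m B)^t* = B^t* *m A^t*.
Proof. by rewrite trmx_mul map_mxM. Qed.

Lemma adjD m n (A B : 'M[C]_(m, n)) : (A + B)^t* = A^t* + B^t*.
Proof. by rewrite linearD /= map_mxD. Qed.

Lemma adjN m n (A : 'M[C]_(m, n)) : (- A)^t* = - A^t*.
Proof. by rewrite linearN /= map_mxN. Qed.

Lemma adjB m n (A B : 'M[C]_(m, n)) : (A - B)^t* = A^t* - B^t*.
Proof. by rewrite adjD adjN. Qed.

Lemma adjZ m n a (A : 'M[C]_(m, n)) : (a *: A)^t* = a^* *: A^t*.
Proof. by rewrite linearZ /= map_mxZ. Qed.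

Lemma adj1 n : (1%:M : 'M[C]_n)^t* = 1%:M.
Proof. by rewrite trmx1 map_mx1. Qed.

Lemma adjV n (A : 'M[C]_n) : (invmx A)^t* = invmx (A^t*).
Proof. by rewrite trmx_inv map_invmx. Qed.

Lemma hermitianP n (M : 'M[C]_n) : M \is hermsymmx <-> M^t* = M.
Proof.
by split=> [/is_hermitianmxP|h]; last (apply/is_hermitianmxP);
  rewrite expr0 scale1r.
Qed.

Lemma hermitian_congr m n (P : 'M[C]_(m, n)) (M : 'M[C]_m) :
  M \is hermsymmx -> P^t* *m M *m P \is hermsymmx.
Proof. by move=> /hermitianP h; apply/hermitianP; rewrite !adjM trmxCK h mulmxA. Qed.

(** This turns what is known of quadratic forms, their vanishing or their
    convergence, into the same for the matrix entries. *)
Lemma polarization n (M : 'M[C]_n) (i j : 'I_n) :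
  let q (w : 'cV[C]_n) := (w^t* *m M *m w) 0 0 in
  let u : 'cV[C]_n := delta_mx i 0 in let v : 'cV[C]_n := delta_mx j 0 in
  4 * M i j =
    q (u + v) - q (u - v) + 'i * (q (u - 'i *: v) - q (u + 'i *: v)).
Proof.
move=> q u v; pose b (x y : 'cV[C]_n) := (x^t* *m M *m y) 0 0.
have entryD (P Q : 'M[C]_1) : (P + Q) 0 0 = P 0 0 + Q 0 0 by rewrite mxE.
have entryZ a (P : 'M[C]_1) : (a *: P) 0 0 = a * P 0 0 by rewrite mxE.
have qD x y : q (x + y) = q x + b x y + (b y x + q y).
  by rewrite /q adjD !mulmxDl !mulmxDr !entryD.
have qZ a x : q (a *: x) = (a^* * a) * q x.
  by rewrite /q adjZ -scalemxAr -!scalemxAl !entryZ mulrA [a * _]mulrC.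
have bZr a x y : b x (a *: y) = a * b x y by rewrite /b -scalemxAr entryZ.
have bZl a x y : b (a *: x) y = a^* * b x y.
  by rewrite /b adjZ -!scalemxAl entryZ.
have -> : M i j = b u v.
  by rewrite /b /u /v -mulmxA -colE trmx_delta map_delta_mx -rowE !mxE.
have hi : 'i * 'i = -1 :> C by rewrite -expr2 sqrCi.
rewrite -!scaleNr -[- v]scaleN1r !qD !qZ !bZr !bZl !rmorphN !rmorph1 conjCi.
rewrite /= conjCi; ring: hi.
Qed.

Lemma quadform_eq0 n (M : 'M[C]_n) :
  (forall v : 'cV[C]_n, (v^t* *m M *m v) 0 0 = 0) -> M = 0.
Proof.
move=> M0; apply/matrixP=> i j; rewrite mxE.
have := polarization M i j; rewrite /= !M0 !subr0 mulr0 addr0 => /eqP.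
by rewrite mulf_eq0 pnatr_eq0 => /eqP.
Qed.
End Adjoint.

(** * The Loewner order *)

Section LoewnerOrder.
Context {C : numClosedFieldType}.

Lemma psdD n (M N : 'M[C]_n) :
  possemidefmx M -> possemidefmx N -> possemidefmx (M + N).
Proof.
move=> [/hermitianP hM pM] [/hermitianP hN pN]; split.
  by apply/hermitianP; rewrite adjD hM hN.
by move=> v; rewrite mulmxDr mulmxDl mxE addr_ge0.
Qed.

Lemma psd_congr m n (P : 'M[C]_(m, n)) (M : 'M[C]_m) :
  possemidefmx M -> possemidefmx (P^t* *m M *m P).
Proof.
move=> [hM pM]; split; first exact: hermitian_congr.
by move=> v; have := pM (P *m v); rewrite adjM !mulmxA.
Qed.

Lemma posdef_psd n (M : 'M[C]_n) : posdefmx M -> possemidefmx M.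
Proof.
move=> [hM pM]; split=> // v; have [->|/pM/ltW//] := eqVneq v 0.
by rewrite mulmx0 mxE.
Qed.

Lemma posdef_psdD n (M N : 'M[C]_n) :
  posdefmx M -> possemidefmx N -> posdefmx (M + N).
Proof.
move=> [/hermitianP hM pM] [/hermitianP hN pN]; split.
  by apply/hermitianP; rewrite adjD hM hN.
by move=> v v0; rewrite mulmxDr mulmxDl mxE ltr_wpDr ?pM.
Qed.

(** A vector in the kernel would annihilate the quadratic form. *)
Lemma posdef_unit n (M : 'M[C]_n) : posdefmx M -> M \in unitmx.
Proof.
move=> [_ pM]; rewrite -unitmx_tr -row_free_unit -kermx_eq0.
apply/eqP/row_matrixP=> i; rewrite row0.
have rM : row i (kermx M^T) *m M^T = 0 by rewrite -row_mul mulmx_ker row0.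
apply/eqP; apply: contraT => r0.
have := pM (row i (kermx M^T))^T; rewrite trmx_eq0 => /(_ r0).
have Mr : M *m (row i (kermx M^T))^T = 0 by rewrite -{1}(trmxK M) -trmx_mul rM trmx0.
by rewrite -mulmxA Mr mulmx0 mxE ltxx.
Qed.

Lemma posdef_congr n (P M : 'M[C]_n) :
  P \in unitmx -> posdefmx M -> posdefmx (P^t* *m M *m P).
Proof.
move=> uP [hM pM]; split; first exact: hermitian_congr.
move=> v v0; have := pM (P *m v); rewrite adjM !mulmxA; apply.
by apply: contra_neq v0 => Pv; rewrite -[v](mulKmx uP) Pv mulmx0.
Qed.

Lemma posdefV n (M : 'M[C]_n) : posdefmx M -> posdefmx (invmx M).
Proof.
move=> pM; have uM := posdef_unit pM; have [/hermitianP hM _] := pM.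
have -> : invmx M = (invmx M)^t* *m M *m invmx M.
  by rewrite adjV hM mulVmx // mul1mx.
by apply: posdef_congr; rewrite // unitmx_inv.
Qed.

Lemma posdef1 n : posdefmx (1%:M : 'M[C]_n).
Proof.
split=> [|v v0]; first by apply/hermitianP; rewrite adj1.
have w0 : v^t* != 0 by rewrite map_mx_eq0 trmx_eq0.
by have := dotmx_is_dotmx w0; rewrite dotmxE trmxCK mulmx1.
Qed.

Lemma loewner_anti n (M N : 'M[C]_n) :
  loewner_le M N -> loewner_le N M -> M = N.
Proof.
move=> [_ MN] [_ NM]; apply/eqP; rewrite -subr_eq0; apply/eqP.
apply: quadform_eq0 => v; apply/eqP; rewrite eq_le NM andbT.
have entryN (P : 'M[C]_1) : (- P) 0 0 = - P 0 0 by rewrite mxE.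
by rewrite -opprB mulmxN mulNmx entryN oppr_le0 MN.
Qed.

Lemma loewner_congr m n (P : 'M[C]_(m, n)) (M N : 'M[C]_m) :
  loewner_le M N -> loewner_le (P^t* *m M *m P) (P^t* *m N *m P).
Proof. by rewrite /loewner_le -mulmxBl -mulmxBr; exact: psd_congr. Qed.

Lemma loewner_rev n (P M N : 'M[C]_n) :
  loewner_le M N -> loewner_le (P - N) (P - M).
Proof. by rewrite /loewner_le => MN; rewrite opprB addrC addrA subrK. Qed.

Lemma loewner_posdef n (M N : 'M[C]_n) :
  posdefmx M -> loewner_le M N -> posdefmx N.
Proof. by move=> pM MN; rewrite -[N](subrKC M); exact: posdef_psdD. Qed.

(** Inversion reverses the order because, for Hermitian [M] and [N], the
    difference [M^-1 - N^-1] is the sum of the congruences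
    [(M^-1 - N^-1) M (M^-1 - N^-1)] and [N^-1 (N - M) N^-1]. *)
Lemma loewner_inv n (M N : 'M[C]_n) :
  posdefmx M -> loewner_le M N -> loewner_le (invmx N) (invmx M).
Proof.
move=> pM MN; have pN := loewner_posdef pM MN.
have [uM uN] := (posdef_unit pM, posdef_unit pN).
have [/hermitianP hM _] := pM; have [/hermitianP hN _] := pN.
have hMN : (invmx M - invmx N)^t* = invmx M - invmx N.
  by rewrite adjB !adjV hM hN.
rewrite /loewner_le; have -> : invmx M - invmx N =
    (invmx M - invmx N)^t* *m M *m (invmx M - invmx N) +
    (invmx N)^t* *m (N - M) *m invmx N.
  rewrite hMN adjV hN.
  have -> : (invmx M - invmx N) *m M *m (invmx M - invmx N) =
      invmx M - invmx N - (invmx N - invmx N *m M *m invmx N).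
    by rewrite !mulmxBl !mulmxBr mulVmx // !mul1mx mulmxK.
  by rewrite mulmxBr mulmxBl mulVmx // mul1mx subrK.
by apply: psdD; apply: psd_congr; [exact: posdef_psd|].
Qed.
End LoewnerOrder.

(** * Limits of monotone sequences of Hermitian matrices *)

Section ComplexLimits.
Context {R : realType}.
Local Open Scope classical_set_scope.
Implicit Types (u v : nat -> R[i]) (l : R[i]).

(** Complex convergence is split into two real limits so that the order and
    completeness of the reals apply directly. *)
Definition ccvg u l : Prop :=
  (fun k => complex.Re (u k)) @ \oo --> complex.Re l /\
  (fun k => complex.Im (u k)) @ \oo --> complex.Im l.

Lemma ReD (x y : R[i]) : complex.Re (x + y) = complex.Re x + complex.Re y.
Proof. by case: x y => [? ?] []. Qed.

Lemma ImD (x y : R[i]) : complex.Im (x + y) = complex.Im x + complex.Im y.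
Proof. by case: x y => [? ?] []. Qed.

Lemma ReM (x y : R[i]) : complex.Re (x * y) =
  complex.Re x * complex.Re y - complex.Im x * complex.Im y.
Proof. by case: x y => [? ?] []. Qed.

Lemma ImM (x y : R[i]) : complex.Im (x * y) =
  complex.Re x * complex.Im y + complex.Im x * complex.Re y.
Proof. by case: x y => [? ?] []. Qed.

Lemma ccvg_cst l : ccvg (fun=> l) l.
Proof. by split; exact: cvg_cst. Qed.

Lemma ccvgD u v l l' : ccvg u l -> ccvg v l' -> ccvg (fun k => u k + v k) (l + l').
Proof.
move=> [ur ui] [vr vi]; split.
  by rewrite ReD; under eq_fun do rewrite ReD; exact: cvgD.
by rewrite ImD; under eq_fun do rewrite ImD; exact: cvgD.
Qed.

Lemma ccvgM u v l l' : ccvg u l -> ccvg v l' -> ccvg (fun k => u k * v k) (l * l').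
Proof.
move=> [ur ui] [vr vi]; split.
  by rewrite ReM; under eq_fun do rewrite ReM; apply: cvgB; exact: cvgM.
by rewrite ImM; under eq_fun do rewrite ImM; apply: cvgD; exact: cvgM.
Qed.

Lemma ccvgZ a u l : ccvg u l -> ccvg (fun k => a * u k) (a * l).
Proof. exact/ccvgM/ccvg_cst. Qed.

Lemma ccvgN u l : ccvg u l -> ccvg (fun k => - u k) (- l).
Proof. by move=> /(ccvgZ (-1)); rewrite mulN1r; under eq_fun do rewrite mulN1r. Qed.

Lemma ccvgB u v l l' : ccvg u l -> ccvg v l' -> ccvg (fun k => u k - v k) (l - l').
Proof. by move=> ul /ccvgN; exact: ccvgD. Qed.

Lemma ccvg_sum (I : Type) (r : seq I) (u : I -> nat -> R[i]) (l : I -> R[i]) :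
  (forall i, ccvg (u i) (l i)) ->
  ccvg (fun k => \sum_(i <- r) u i k) (\sum_(i <- r) l i).
Proof.
move=> ul; elim: r => [|i r IHr].
  by rewrite big_nil; under eq_fun do rewrite big_nil; exact: ccvg_cst.
by rewrite big_cons; under eq_fun do rewrite big_cons; exact: ccvgD.
Qed.

Lemma ccvg_shift u l : ccvg u l -> ccvg (fun k => u k.+1) l.
Proof. by move=> [ur ui]; split; rewrite (cvg_shiftS (fun k => _ (u k))). Qed.

Lemma ccvg_limE u l : ccvg u l ->
  l = Complex (limn (fun k => complex.Re (u k)))
              (limn (fun k => complex.Im (u k))).
Proof.
move=> [ur ui]; rewrite (cvg_lim _ ur) // (cvg_lim _ ui) //; by case: l ur ui.
Qed.

Lemma ccvg_unique u l l' : ccvg u l -> ccvg u l' -> l = l'.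
Proof. by move=> /ccvg_limE-> /ccvg_limE->. Qed.

Lemma ccvg_ge0 u l : ccvg u l -> (forall k, 0 <= u k) -> 0 <= l.
Proof.
move=> [ur ui] u0; rewrite lecE /=.
have ri k : (complex.Im (u k) = 0) * (0 <= complex.Re (u k)).
  by have := u0 k; rewrite lecE /= => /andP[/eqP].
apply/andP; split; last first.
  by rewrite -(cvg_lim _ ur) //; apply: limr_ge; [exact: cvgP ur|
     apply: nearW => k; rewrite ri].
move: ui; under eq_fun do rewrite ri.
by move=> /cvg_lim <- //; rewrite lim_cst.
Qed.

Lemma ccvg_nonincreasing u : (forall k, 0 <= u k) -> (forall k, u k.+1 <= u k) ->
  exists l, ccvg u l.
Proof.
move=> u0 ud.
have ri k : (complex.Im (u k) = 0) * (0 <= complex.Re (u k)).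
  by have := u0 k; rewrite lecE /= => /andP[/eqP].
exists (Complex (limn (fun k => complex.Re (u k))) 0); split => /=; last first.
  by under eq_fun do rewrite ri; exact: cvg_cst.
apply: nonincreasing_is_cvgn.
  apply/nonincreasing_seqP => k.
  by have := ud k; rewrite lecE => /andP[].
by exists 0 => _ [k _ <-]; rewrite ri.
Qed.

Definition mxcvg m n (M : nat -> 'M[R[i]]_(m, n)) (L : 'M[R[i]]_(m, n)) : Prop :=
  forall i j, ccvg (fun k => M k i j) (L i j).

Lemma mxcvg_cst m n (L : 'M[R[i]]_(m, n)) : mxcvg (fun=> L) L.
Proof. by move=> i j; exact: ccvg_cst. Qed.

Lemma mxcvgD m n (M N : nat -> 'M[R[i]]_(m, n)) K L :
  mxcvg M K -> mxcvg N L -> mxcvg (fun k => M k + N k) (K + L).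
Proof.
move=> MK NL i j; rewrite mxE; under eq_fun do rewrite mxE.
exact: ccvgD.
Qed.

Lemma mxcvgN m n (M : nat -> 'M[R[i]]_(m, n)) K :
  mxcvg M K -> mxcvg (fun k => - M k) (- K).
Proof.
by move=> MK i j; rewrite mxE; under eq_fun do rewrite mxE; exact: ccvgN.
Qed.

Lemma mxcvgM m n p (M : nat -> 'M[R[i]]_(m, n)) (N : nat -> 'M[R[i]]_(n, p)) K L :
  mxcvg M K -> mxcvg N L -> mxcvg (fun k => M k *m N k) (K *m L).
Proof.
move=> MK NL i j; rewrite mxE; under eq_fun do rewrite mxE.
by apply: ccvg_sum => l; exact: ccvgM.
Qed.

Lemma mxcvg_shift m n (M : nat -> 'M[R[i]]_(m, n)) K :
  mxcvg M K -> mxcvg (fun k => M k.+1) K.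
Proof. by move=> MK i j; exact: (ccvg_shift (MK i j)). Qed.

Lemma mxcvg_unique m n (M : nat -> 'M[R[i]]_(m, n)) K L :
  mxcvg M K -> mxcvg M L -> K = L.
Proof. by move=> MK ML; apply/matrixP=> i j; exact: ccvg_unique (MK i j) (ML i j). Qed.

Lemma mxcvg_quadform n (M : nat -> 'M[R[i]]_n) L (v : 'cV[R[i]]_n) :
  mxcvg M L -> ccvg (fun k => (v^t* *m M k *m v) 0 0) ((v^t* *m L *m v) 0 0).
Proof.
by move=> ML; apply: (mxcvgM (mxcvgM (mxcvg_cst _) ML) (mxcvg_cst _)).
Qed.

(** Over the complex numbers hermiticity follows from the positivity of the
    form: a real form makes that of [M^* - M] vanish. *)
Lemma quadform_ge0_psd n (M : 'M[R[i]]_n) :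
  (forall v : 'cV[R[i]]_n, 0 <= (v^t* *m M *m v) 0 0) -> possemidefmx M.
Proof.
move=> M0; split=> //; apply/hermitianP/eqP; rewrite -subr_eq0; apply/eqP.
apply: quadform_eq0 => v; rewrite mulmxBr mulmxBl.
have -> : v^t* *m M^t* *m v = (v^t* *m M *m v)^t* by rewrite !adjM trmxCK mulmxA.
have adjE (P : 'M[R[i]]_1) : (P^t* - P) 0 0 = (P 0 0)^* - P 0 0 by rewrite !mxE.
by rewrite adjE conj_Creal ?subrr // ger0_real.
Qed.

Lemma psd_lim n (M : nat -> 'M[R[i]]_n) L :
  mxcvg M L -> (forall k, possemidefmx (M k)) -> possemidefmx L.
Proof.
move=> ML pM; apply: quadform_ge0_psd => v.
by apply: (ccvg_ge0 (mxcvg_quadform v ML)) => k; case: (pM k) => _; apply.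
Qed.

Lemma loewner_lim_ge n (M : nat -> 'M[R[i]]_n) L B :
  mxcvg M L -> (forall k, loewner_le B (M k)) -> loewner_le B L.
Proof.
move=> ML; apply: psd_lim; apply: mxcvgD => //; exact: mxcvg_cst.
Qed.

(** Every quadratic form of the sequence is a bounded monotone real sequence,
    and polarization turns the convergence of the forms into that of the
    entries. *)
Lemma loewner_nonincreasing_cvg n (M : nat -> 'M[R[i]]_n) B :
  (forall k, loewner_le (M k.+1) (M k)) -> (forall k, loewner_le B (M k)) ->
  exists L, mxcvg M L.
Proof.
move=> Md MB.
have qcvg (v : 'cV[R[i]]_n) : exists l, ccvg (fun k => (v^t* *m M k *m v) 0 0) l.
  have entryB (P Q : 'M[R[i]]_1) : (P - Q) 0 0 = P 0 0 - Q 0 0 by rewrite !mxE.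
  pose u k := (v^t* *m (M k - B) *m v) 0 0.
  have [|k|l ul] := @ccvg_nonincreasing u.
  - by move=> k; case: (MB k) => _; apply.
  - case: (Md k) => _ /(_ v).
    by rewrite /u !(mulmxBr, mulmxBl) !entryB lerD2r subr_ge0.
  exists (l + (v^t* *m B *m v) 0 0).
  have := ccvgD ul (ccvg_cst ((v^t* *m B *m v) 0 0)).
  by under eq_fun do rewrite /u mulmxBr mulmxBl entryB subrK.
(* Four forms determine the entry [(i, j)], by polarization. *)
have ecvg i j : exists l, ccvg (fun k => M k i j) l.
  pose e i : 'cV[R[i]]_n := delta_mx i 0.
  have [a ca] := qcvg (e i + e j); have [b cb] := qcvg (e i - e j).
  have [c cc] := qcvg (e i - 'i *: e j); have [d cd] := qcvg (e i + 'i *: e j).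
  exists (4^-1 * (a - b + 'i * (c - d))).
  have -> : (fun k => M k i j) = fun k => 4^-1 * (4 * M k i j).
    by apply/funext => k; rewrite mulKf // pnatr_eq0.
  under eq_fun do rewrite polarization.
  exact: ccvgZ (ccvgD (ccvgB ca cb) (ccvgZ 'i (ccvgB cc cd))).
exists (\matrix_(i, j) Complex (limn (fun k => complex.Re (M k i j)))
                               (limn (fun k => complex.Im (M k i j)))).
by move=> i j; rewrite mxE; have [l cl] := ecvg i j; rewrite -(ccvg_limE cl).
Qed.
End ComplexLimits.

(** * The equation with an arbitrary coefficient *)

Section Equation.
Context {C : numClosedFieldType}.

(** Equation (b) with an arbitrary complex coefficient [B]: the adjoint of [B]
    takes the place of the transpose, the two being equal when [B] is real. *)
Definition nme n (B W : 'M[C]_n) : Prop :=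
  W + B^t* *m invmx W *m B = 1%:M.

Lemma invmx_eq n (A B : 'M[C]_n) : A *m B = 1%:M -> invmx A = B.
Proof.
by move=> AB; have [uA _] := mulmx1_unit AB; rewrite -[B](mulKmx uA) AB mulmx1.
Qed.

Lemma nme_le1 n (B W : 'M[C]_n) : posdef_sol (nme B) W -> loewner_le W 1%:M.
Proof.
move=> [/posdefV/posdef_psd pW <-].
by rewrite /loewner_le addrC addKr; exact: psd_congr.
Qed.

(** For invertible [B] the two terms of the equation can exchange their roles:
    [1 - W = B^* W^-1 B] is positive definite and [W = B (1 - W)^-1 B^*]. *)
Lemma nme_dual n (B W : 'M[C]_n) : B \in unitmx ->
  posdef_sol (nme B) W -> posdef_sol (nme (B^t*)) (1%:M - W).
Proof.
move=> uB [pW eW]; have uW := posdef_unit pW.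
have eZ : 1%:M - W = B^t* *m invmx W *m B by rewrite -eW addrC addKr.
split; first by rewrite eZ; apply: posdef_congr => //; exact: posdefV.
have uB' : B^t* \in unitmx by rewrite map_unitmx unitmx_tr.
have iZ : invmx (1%:M - W) = invmx B *m W *m invmx (B^t*).
  apply: invmx_eq; rewrite eZ !mulmxA mulmxK // mulmxKV //.
  by rewrite mulmxV.
by rewrite /nme iZ trmxCK !mulmxA mulmxV // mul1mx mulmxKV // subrK.
Qed.

Section UnitaryCongruence.
Context {n : nat} (T : 'M[C]_n) (uT : T \is unitarymx).

Lemma unitary_mulV : T *m T^t* = 1%:M.
Proof. exact/unitarymxP. Qed.

Lemma unitary_mulVl : T^t* *m T = 1%:M.
Proof. exact/mulmx1C/unitary_mulV. Qed.

Lemma unitary_congrM (M N : 'M[C]_n) :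
  (T *m M *m T^t*) *m (T *m N *m T^t*) = T *m (M *m N) *m T^t*.
Proof. by rewrite !mulmxA -(mulmxA (T *m M)) unitary_mulVl mulmx1. Qed.

Lemma unitary_congr_adj (M : 'M[C]_n) : (T *m M *m T^t*)^t* = T *m M^t* *m T^t*.
Proof. by rewrite !adjM trmxCK mulmxA. Qed.

Lemma unitary_congrK (M : 'M[C]_n) : T^t* *m (T *m M *m T^t*) *m T = M.
Proof.
by rewrite !mulmxA unitary_mulVl mul1mx -mulmxA unitary_mulVl mulmx1.
Qed.

Lemma unitary_congrV (M : 'M[C]_n) : M \in unitmx ->
  invmx (T *m M *m T^t*) = T *m invmx M *m T^t*.
Proof.
by move=> uM; apply: invmx_eq; rewrite unitary_congrM mulmxV // mulmx1 unitary_mulV.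
Qed.

Lemma posdef_unitary (M : 'M[C]_n) : posdefmx M -> posdefmx (T *m M *m T^t*).
Proof.
move=> pM; rewrite -{1}(trmxCK T); apply: posdef_congr => //.
by rewrite map_unitmx unitmx_tr unitarymx_unit.
Qed.

Lemma nme_unitary (B W : 'M[C]_n) :
  posdef_sol (nme B) W -> posdef_sol (nme (T *m B *m T^t*)) (T *m W *m T^t*).
Proof.
move=> [pW eW]; split; first exact: posdef_unitary.
rewrite /nme unitary_congrV ?posdef_unit // unitary_congr_adj !unitary_congrM.
by rewrite -mulmxDl -mulmxDr eW mulmx1 unitary_mulV.
Qed.

Lemma loewner_unitary (M N : 'M[C]_n) :
  loewner_le (T *m M *m T^t*) (T *m N *m T^t*) <-> loewner_le M N.
Proof.
split=> [/(loewner_congr T)|]; first by rewrite !unitary_congrK.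
by move=> /(loewner_congr (T^t*)); rewrite trmxCK.
Qed.
End UnitaryCongruence.

Lemma nme_unitaryE n (T B W : 'M[C]_n) : T \is unitarymx ->
  posdef_sol (nme (T *m B *m T^t*)) (T *m W *m T^t*) <-> posdef_sol (nme B) W.
Proof.
move=> uT; split; last exact: nme_unitary.
have uT' : T^t* \is unitarymx by rewrite trmxC_unitary.
by move=> /(nme_unitary uT'); rewrite trmxCK !unitary_congrK.
Qed.

Lemma sandwichK n (F W : 'M[C]_n) : F *m F = 1%:M -> F *m (F *m W *m F) *m F = W.
Proof. by move=> FF; rewrite !mulmxA FF mul1mx -mulmxA FF mulmx1. Qed.

Lemma nmeN n (B W : 'M[C]_n) : nme (- B) W -> nme B W.
Proof. by rewrite /nme adjN mulmxN !mulNmx opprK. Qed.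

Lemma quadform_conj n (M : 'M[C]_n) (v : 'cV[C]_n) :
  (v^t* *m map_mx Num.conj M *m v) 0 0 =
  (((map_mx Num.conj v)^t* *m M *m map_mx Num.conj v) 0 0)^*.
Proof.
have conjE (P : 'M[C]_1) : (P 0 0)^* = (map_mx Num.conj P) 0 0 by rewrite mxE.
by rewrite conjE !map_mxM -map_trmx !map_mxCK.
Qed.

Lemma conj_hermitian n (M : 'M[C]_n) :
  M \is hermsymmx -> map_mx Num.conj M \is hermsymmx.
Proof.
by move=> /hermitianP hM; apply/hermitianP; rewrite -[in RHS]hM -!map_trmx.
Qed.

Lemma conj_posdef n (M : 'M[C]_n) : posdefmx M -> posdefmx (map_mx Num.conj M).
Proof.
move=> [hM pM]; split=> [|v v0]; first exact: conj_hermitian.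
by rewrite quadform_conj lt_def fmorph_eq0 conjC_ge0 -lt_def pM // map_mx_eq0.
Qed.

Lemma conj_loewner n (M N : 'M[C]_n) :
  loewner_le M N -> loewner_le (map_mx Num.conj M) (map_mx Num.conj N).
Proof.
move=> [hMN pMN]; rewrite /loewner_le -map_mxB; split; first exact: conj_hermitian.
by move=> v; rewrite quadform_conj conjC_ge0 pMN.
Qed.

Lemma nme_conj n (B W : 'M[C]_n) : posdef_sol (nme B) W ->
  posdef_sol (nme (map_mx Num.conj B)) (map_mx Num.conj W).
Proof.
move=> [pW eW]; split; first exact: conj_posdef.
by rewrite /nme map_trmx -map_invmx -!map_mxM -map_mxD eW map_mx1.
Qed.

(** An order-preserving involution that preserves the solutions fixes
    the maximal one: maximality gives [f W <= W], and applying [f] to this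
    gives [W <= f W]. *)
Lemma maximal_invariant n (S : 'M[C]_n -> Prop) (f : 'M[C]_n -> 'M[C]_n) W :
  (forall M, f (f M) = M) ->
  (forall M N, loewner_le M N -> loewner_le (f M) (f N)) ->
  (forall M, posdef_sol S M -> posdef_sol S (f M)) ->
  maximal_posdef_sol S W -> f W = W.
Proof.
move=> fK fle fS [sW maxW]; apply: loewner_anti; first exact/maxW/fS.
by rewrite -{1}[W]fK; apply/fle/maxW/fS.
Qed.

Lemma minimal_invariant n (S : 'M[C]_n -> Prop) (f : 'M[C]_n -> 'M[C]_n) W :
  (forall M, f (f M) = M) ->
  (forall M N, loewner_le M N -> loewner_le (f M) (f N)) ->
  (forall M, posdef_sol S M -> posdef_sol S (f M)) ->
  minimal_posdef_sol S W -> f W = W.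
Proof.
move=> fK fle fS [sW minW]; apply: loewner_anti; last exact/minW/fS.
by rewrite -{2}[W]fK; apply/fle/minW/fS.
Qed.

Lemma maximal_unique n (S : 'M[C]_n -> Prop) V W :
  maximal_posdef_sol S V -> maximal_posdef_sol S W -> V = W.
Proof.
by move=> [sV mV] [sW mW]; apply: loewner_anti; [exact: mW|exact: mV].
Qed.

Lemma minimal_unique n (S : 'M[C]_n -> Prop) V W :
  minimal_posdef_sol S V -> minimal_posdef_sol S W -> V = W.
Proof.
by move=> [sV mV] [sW mW]; apply: loewner_anti; [exact: mV|exact: mW].
Qed.
End Equation.

(** * Existence of extremal solutions *)

Section Existence.
Context {R : realType} {n : nat}.
Implicit Types B W : 'M[R[i]]_n.

Fixpoint nme_iter B k : 'M[R[i]]_n :=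
  if k is k'.+1 then 1%:M - B^t* *m invmx (nme_iter B k') *m B else 1%:M.

Lemma nme_iter_ge B W k : posdef_sol (nme B) W -> loewner_le W (nme_iter B k).
Proof.
move=> sW; have [pW eW] := sW; elim: k => [|k IHk] /=; first exact: nme_le1 sW.
have -> : W = 1%:M - B^t* *m invmx W *m B by rewrite -eW addrK.
by apply/loewner_rev/loewner_congr/loewner_inv.
Qed.

Lemma nme_iter_posdef B W k : posdef_sol (nme B) W -> posdefmx (nme_iter B k).
Proof. by move=> sW; exact: loewner_posdef (proj1 sW) (nme_iter_ge k sW). Qed.

Lemma nme_iter_le B W k : posdef_sol (nme B) W ->
  loewner_le (nme_iter B k.+1) (nme_iter B k).
Proof.
move=> sW; elim: k => [|k IHk].
  rewrite /loewner_le opprB addrC subrK.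
  exact/psd_congr/posdef_psd/posdefV/posdef1.
apply/loewner_rev/loewner_congr/loewner_inv; last exact: IHk.
exact: (nme_iter_posdef k.+1 sW).
Qed.

(** The iterates decrease and stay above every solution, so they converge to a
    positive definite [L] above every solution. Their inverses increase and
    stay below the inverse of any solution, so they converge as well, to an
    inverse of [L]; this lets the recurrence pass to the limit without any
    appeal to the continuity of inversion. *)
Lemma nme_maximal B : (exists W, posdef_sol (nme B) W) ->
  exists W, maximal_posdef_sol (nme B) W.
Proof.
move=> [W sW]; pose X k := nme_iter B k.
have uX k : X k \in unitmx by apply/posdef_unit/nme_iter_posdef/sW.
have [L XL] : exists L, mxcvg X L.
  apply: (@loewner_nonincreasing_cvg _ _ _ W) => k.
    exact: nme_iter_le sW.
  exact: nme_iter_ge.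
have [Z XZ] : exists Z, mxcvg (fun k => - invmx (X k)) Z.
  apply: (@loewner_nonincreasing_cvg _ _ _ (- invmx W)) => k.
    rewrite -[- invmx (X k.+1)]add0r -[- invmx (X k)]add0r.
    apply/loewner_rev/loewner_inv; last exact: nme_iter_le sW.
    exact: nme_iter_posdef sW.
  rewrite -[- invmx W]add0r -[- invmx (X k)]add0r.
  by apply/loewner_rev/loewner_inv; [case: sW|exact: nme_iter_ge].
(* The limit theorem is about decreasing sequences, whence the signs. *)
have iXZ : mxcvg (fun k => invmx (X k)) (- Z).
  by have := mxcvgN XZ; under eq_fun do rewrite opprK.
have LZ : invmx L = - Z.
  apply: invmx_eq; apply: mxcvg_unique (mxcvgM XL iXZ) _.
  by under eq_fun do rewrite mulmxV //; exact: mxcvg_cst.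
have geL Y : posdef_sol (nme B) Y -> loewner_le Y L.
  by move=> sY; apply: (loewner_lim_ge XL) => k; exact: nme_iter_ge.
exists L; split; last exact: geL.
split; first exact: loewner_posdef (proj1 sW) (geL _ sW).
have eL : L = 1%:M - B^t* *m invmx L *m B.
  apply: mxcvg_unique (mxcvg_shift XL) _; rewrite LZ.
  apply: mxcvgD; first exact: mxcvg_cst.
  by apply/mxcvgN/mxcvgM/mxcvg_cst/mxcvgM => //; exact: mxcvg_cst.
by rewrite /nme {1}eL subrK.
Qed.

(** The map [W => 1 - W] reverses the order and exchanges the solutions for [B]
    and for [B^*], so it turns a maximal solution into a minimal one. *)
Lemma nme_minimal B : B \in unitmx -> (exists W, posdef_sol (nme B) W) ->
  exists W, minimal_posdef_sol (nme B) W.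
Proof.
move=> uB [W sW].
have uB' : B^t* \in unitmx by rewrite map_unitmx unitmx_tr.
have [|Z [sZ maxZ]] := @nme_maximal (B^t*).
  by exists (1%:M - W); exact: nme_dual.
exists (1%:M - Z); split; first by rewrite -{1}(trmxCK B); exact: nme_dual.
move=> Y sY; rewrite -[Y](subKr 1%:M).
by apply/loewner_rev/maxZ/nme_dual.
Qed.
End Existence.

(** * Block diagonalization of the real representations *)

Section BlockDiagonalization.
Context {R : rcfType} {n : nat}.
Local Notation C := R[i].
Local Notation conjmat := (map_mx Num.conj).
Implicit Types (A X Y P Q : 'M[C]_n).

Lemma eq_blocks P Q X Y P' Q' X' Y' : P = P' -> Q = Q' -> X = X' -> Y = Y' ->
  block_mx P Q X Y = block_mx P' Q' X' Y'.
Proof. by move=> -> -> -> ->. Qed.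

Lemma sqr_ic : 'i%C * 'i%C = -1 :> C.
Proof. by rewrite -expr2 sqr_i. Qed.

Lemma conj_ic : ('i%C : C)^* = - 'i%C.
Proof. by rewrite -[LHS]/(conjc _); apply/eqP; rewrite eq_complex /= oppr0 !eqxx. Qed.

(** The two block columns span the eigenspaces of the complex structure
    [heartmx ('i%C)%:M], for the eigenvalues [j] and [-j]; the scalar makes the
    matrix unitary. *)
Definition jbasis : 'M[C]_(n + n) :=
  sqrtC 2^-1 *: row_mx (jcolmx n) (conjmat (jcolmx n)).

Lemma jbasis_block : jbasis =
  sqrtC 2^-1 *: block_mx 'i%C%:M (- 'i%C)%:M 1%:M 1%:M.
Proof.
rewrite /jbasis /jcolmx map_col_mx map_scalar_mx map_mx1 /= conj_ic.
by rewrite block_mxEh.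
Qed.

(** The whole correspondence between the complex and the real picture is read
    off this one formula by specializing the four blocks. *)
Lemma jbasis_congr P Q X Y : jbasis *m block_mx P Q X Y *m jbasis^t* =
  2^-1 *: block_mx (P - Q - X + Y) ('i%C *: (P + Q - X - Y))
                   ('i%C *: (Q + Y - P - X)) (P + Q + X + Y).
Proof.
have -> : jbasis^t* =
    sqrtC 2^-1 *: block_mx (- 'i%C)%:M 1%:M 'i%C%:M 1%:M.
  rewrite jbasis_block adjZ tr_block_mx map_block_mx !tr_scalar_mx.
  rewrite !map_scalar_mx /= rmorphN rmorph1 /= !conj_ic opprK.
  by rewrite conj_Creal // ger0_real // sqrtC_ge0 invr_ge0 ler0n.
rewrite jbasis_block -!scalemxAl -scalemxAr scalerA -expr2 sqrtCK.
congr (_ *: _); rewrite !mulmx_block.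
rewrite !(mul_scalar_mx, mul_mx_scalar, scale1r).
have hi := sqr_ic.
by apply: eq_blocks; apply/matrixP=> a b; rewrite !mxE; ring: hi.
Qed.

Lemma jbasis_unitary : jbasis \is unitarymx.
Proof.
apply/unitarymxP; rewrite -[X in X *m _]mulmx1 [1%:M in LHS]scalar_mx_block.
rewrite jbasis_congr scale_block_mx [RHS]scalar_mx_block.
have h2 : 2^-1 * 2 = 1 :> C by rewrite mulVf // pnatr_eq0.
by apply: eq_blocks; apply/matrixP=> a b; rewrite !mxE; ring: h2.
Qed.

Definition conjdiag X : 'M[C]_(n + n) := block_mx X 0 0 (conjmat X).

Definition conjanti A : 'M[C]_(n + n) :=
  block_mx 0 (- 'i%C *: conjmat A) ('i%C *: A) 0.

Lemma Re_half (x : C) : (complex.Re x)%:C%C = 2^-1 * (x + x^*).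
Proof. by rewrite ReJ_add mulrC. Qed.

Lemma Im_half (x : C) : (complex.Im x)%:C%C = 2^-1 * ('i%C * (x^* - x)).
Proof. by rewrite ImJ_sub -mulrA mulrC -mulrA [_ * (_ - _)]mulrC. Qed.

Lemma heart_diag X : mx_complex (heartmx X) = jbasis *m conjdiag X *m jbasis^t*.
Proof.
rewrite jbasis_congr scale_block_mx /mx_complex /heartmx map_block_mx.
apply: eq_blocks; apply/matrixP=> a b;
  rewrite !mxE ?rmorphN /= ?Re_half ?Im_half; ring.
Qed.

Lemma lozenge_anti A : mx_complex (lozengemx A) = jbasis *m conjanti A *m jbasis^t*.
Proof.
rewrite jbasis_congr scale_block_mx /mx_complex /lozengemx map_block_mx.
have hi := sqr_ic.
apply: eq_blocks; apply/matrixP=> a b;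
  rewrite !mxE ?rmorphN /= ?Re_half ?Im_half; ring: hi.
Qed.

(** Conjugation exchanges the two block columns of [jbasis], hence the diagonal
    blocks with each other and the off-diagonal blocks with each other. *)
Lemma jbasis_conj P Q X Y :
  conjmat (jbasis *m block_mx P Q X Y *m jbasis^t*) =
  jbasis *m block_mx (conjmat Y) (conjmat X) (conjmat Q) (conjmat P) *m jbasis^t*.
Proof.
rewrite !jbasis_congr map_mxZ map_block_mx fmorphV rmorph_nat; congr (_ *: _).
rewrite !map_mxZ !(map_mxD, map_mxN) /= conj_ic.
move: (conjmat P) (conjmat Q) (conjmat X) (conjmat Y) => P' Q' X' Y'.
by apply: eq_blocks; apply/matrixP=> a b; rewrite !mxE; ring.
Qed.

Lemma mx_complex_real m p (M : 'M[R]_(m, p)) : conjmat (mx_complex M) = mx_complex M.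
Proof. by apply/matrixP=> a b; rewrite !mxE -[LHS]/(conjc _) conjc_real. Qed.

(** Congruence by the signature changes the sign of the off-diagonal blocks, so
    it fixes the block diagonal matrices and negates the block antidiagonal
    ones. *)
Definition signdiag : 'M[C]_(n + n) := block_mx 1%:M 0 0 (- 1)%:M.

Lemma signdiag_adj : signdiag^t* = signdiag.
Proof.
rewrite tr_block_mx map_block_mx; apply: eq_blocks; rewrite ?trmx0 ?map_mx0 //.
  exact: adj1.
by rewrite tr_scalar_mx map_scalar_mx /= rmorphN rmorph1.
Qed.

Lemma signdiag_congr P Q X Y :
  signdiag *m block_mx P Q X Y *m signdiag = block_mx P (- Q) (- X) Y.
Proof.
rewrite /signdiag; have <- : 0%:M = 0 :> 'M[C]_n by rewrite raddf0.
rewrite !mulmx_block !(mul_scalar_mx, mul_mx_scalar).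
by apply: eq_blocks; apply/matrixP=> a b; rewrite !mxE; ring.
Qed.

Lemma signdiag_sqr : signdiag *m signdiag = 1%:M.
Proof.
have := signdiag_congr 1%:M 0 0 1%:M.
by rewrite oppr0 -scalar_mx_block mulmx1.
Qed.

Definition jflip : 'M[C]_(n + n) := jbasis *m signdiag *m jbasis^t*.

Lemma jflip_adj : jflip^t* = jflip.
Proof. by rewrite /jflip (unitary_congr_adj jbasis) signdiag_adj. Qed.

Lemma jflip_sqr : jflip *m jflip = 1%:M.
Proof.
rewrite (unitary_congrM jbasis_unitary) signdiag_sqr.
by rewrite mulmx1 (unitary_mulV jbasis_unitary).
Qed.

Lemma jflip_unitary : jflip \is unitarymx.
Proof. by apply/unitarymxP; rewrite jflip_adj jflip_sqr. Qed.

Lemma jflip_congr P Q X Y :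
  jflip *m (jbasis *m block_mx P Q X Y *m jbasis^t*) *m jflip =
  jbasis *m block_mx P (- Q) (- X) Y *m jbasis^t*.
Proof.
by rewrite !(unitary_congrM jbasis_unitary) signdiag_congr.
Qed.

Lemma lozenge_flip A :
  jflip *m mx_complex (lozengemx A) *m jflip = - mx_complex (lozengemx A).
Proof.
rewrite lozenge_anti jflip_congr -[X in _ = X]mulNmx -mulmxN.
by rewrite /conjanti opp_block_mx oppr0.
Qed.

(** In the basis [jbasis], invariance under [jflip] kills the off-diagonal
    blocks, and being real makes the diagonal blocks conjugate to each other. *)
Lemma heart_of_invariant (W : 'M[C]_(n + n)) :
  conjmat W = W -> jflip *m W *m jflip = W ->
  exists X, W = mx_complex (heartmx X).
Proof.
have uT := jbasis_unitary; pose M := jbasis^t* *m W *m jbasis.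
have uT' : jbasis^t* \is unitarymx by rewrite trmxC_unitary.
have := unitary_congrK uT' W; rewrite trmxCK -/M -(submxK M) => <-.
set P := ulsubmx M; set Q := ursubmx M; set X := dlsubmx M; set Y := drsubmx M.
have inj (U V : 'M[C]_(n + n)) :
    jbasis *m U *m jbasis^t* = jbasis *m V *m jbasis^t* -> U = V.
  by move=> UV; rewrite -(unitary_congrK uT U) UV (unitary_congrK uT V).
have opp0 (U : 'M[C]_n) : - U = U -> U = 0.
  move=> UU; apply/eqP; have /eqP := subrr U.
  by rewrite -{2}UU opprK -mulr2n -scaler_nat scaler_eq0 pnatr_eq0 => /eqP->.
rewrite jbasis_conj jflip_congr => /inj/eq_block_mx[_ _ _ PY].
move=> /inj/eq_block_mx[_ /opp0 Q0 /opp0 X0 _].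
by exists P; rewrite heart_diag /conjdiag PY Q0 X0.
Qed.
End BlockDiagonalization.

(** * Correspondence between the two equations *)

Section Correspondence.
Context {R : rcfType} {n : nat}.
Local Notation C := R[i].
Local Notation conjmat := (map_mx Num.conj).
Local Notation heart X := (mx_complex (heartmx X)).
Implicit Types (A X Y P Q : 'M[C]_n).

Lemma conjdiagD X Y : conjdiag (X + Y) = conjdiag X + conjdiag Y.
Proof. by rewrite /conjdiag map_mxD add_block_mx !addr0. Qed.

Lemma conjdiagB X Y : conjdiag (X - Y) = conjdiag X - conjdiag Y.
Proof. by rewrite /conjdiag map_mxB opp_block_mx add_block_mx !subr0. Qed.

Lemma conjdiag1 : conjdiag (1%:M : 'M[C]_n) = 1%:M.
Proof. by rewrite /conjdiag map_mx1 -scalar_mx_block. Qed.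

Lemma conjdiag_inj : injective (@conjdiag R n).
Proof. by move=> X Y /eq_block_mx[]. Qed.

Lemma conjdiagM X Y : conjdiag (X *m Y) = conjdiag X *m conjdiag Y.
Proof.
by rewrite /conjdiag mulmx_block !mulmx0 !mul0mx !addr0 !add0r map_mxM.
Qed.

Lemma conjdiag_inv X : X \in unitmx -> invmx (conjdiag X) = conjdiag (invmx X).
Proof. by move=> uX; apply: invmx_eq; rewrite -conjdiagM mulmxV ?conjdiag1. Qed.

Lemma conjdiag_adj X : (conjdiag X)^t* = conjdiag (X^t*).
Proof. by rewrite /conjdiag tr_block_mx map_block_mx !trmx0 !map_mx0 map_trmx. Qed.

Lemma conjanti_adj A : (conjanti A)^t* = conjanti (A^T).
Proof.
rewrite /conjanti tr_block_mx map_block_mx !trmx0 !map_mx0.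
by apply: eq_blocks; rewrite // adjZ ?rmorphN /= conj_ic ?opprK -?map_trmx ?map_mxCK.
Qed.

Lemma conjdiag_anti X A :
  conjdiag X *m conjanti A = conjanti (conjmat X *m A).
Proof.
rewrite /conjdiag /conjanti mulmx_block !mulmx0 !mul0mx !addr0 !add0r.
by rewrite -!scalemxAr map_mxM map_mxCK.
Qed.

Lemma conjantiM A B : conjanti A *m conjanti B = conjdiag (conjmat A *m B).
Proof.
rewrite /conjdiag /conjanti mulmx_block !mulmx0 !mul0mx !addr0 !add0r.
rewrite -!scalemxAr -!scalemxAl !scalerA mulNr mulrN sqr_ic opprK !scale1r.
by rewrite map_mxM map_mxCK.
Qed.

(** The product of two block antidiagonal factors is block diagonal; each passage
    through one of them conjugates, which is where the conjugate of [X] in (a)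
    comes from. *)
Lemma nme_conjdiag A X : X \in unitmx ->
  nme (conjanti A) (conjdiag X) <-> eq_a A X.
Proof.
move=> uX; rewrite /nme /eq_a conjdiag_inv // conjanti_adj -mulmxA.
rewrite conjdiag_anti conjantiM -conjdiagD -conjdiag1 mulmxA map_invmx.
by split=> [/conjdiag_inj|->].
Qed.

Lemma quadform_conjdiag X (u w : 'cV[C]_n) :
  ((col_mx u w)^t* *m conjdiag X *m col_mx u w) 0 0 =
  (u^t* *m X *m u) 0 0 + (w^t* *m conjmat X *m w) 0 0.
Proof.
rewrite tr_col_mx map_row_mx mul_row_block !mulmx0 addr0 add0r mul_row_col.
by rewrite [LHS]mxE.
Qed.

Lemma psd_conjdiag X : possemidefmx (conjdiag X) <-> possemidefmx X.
Proof.
split=> [[/hermitianP hD pD]|pX].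
  split=> [|u]; last first.
    by have := pD (col_mx u 0); rewrite quadform_conjdiag mulmx0 [X in _ + X]mxE addr0.
  by apply/hermitianP/conjdiag_inj; rewrite -conjdiag_adj.
have [/hermitianP hX qX] := pX; split.
  by apply/hermitianP; rewrite conjdiag_adj hX.
move=> v; rewrite -(vsubmxK v) quadform_conjdiag addr_ge0 //.
by rewrite quadform_conj conjC_ge0 qX.
Qed.

Lemma posdef_conjdiag X : posdefmx (conjdiag X) <-> posdefmx X.
Proof.
split=> [pD|pX].
  have [[hX _] [_ qD]] := (proj1 (psd_conjdiag X) (posdef_psd pD), pD).
  split=> // u u0; have := qD (col_mx u 0).
  rewrite quadform_conjdiag mulmx0 [X in _ + X]mxE addr0; apply.
  by rewrite col_mx_eq0 negb_and u0.
have [[hD _] [_ qX]] := (proj2 (psd_conjdiag X) (posdef_psd pX), pX).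
have [_ sX] := posdef_psd pX.
split=> // v; rewrite -(vsubmxK v) quadform_conjdiag col_mx_eq0 negb_and.
rewrite quadform_conj => /orP[v0|v0].
  by rewrite ltr_wpDr ?conjC_ge0 ?sX ?qX.
by rewrite ltr_wpDl ?sX // lt_def fmorph_eq0 conjC_ge0 -lt_def qX ?map_mx_eq0.
Qed.

(** An equality of predicates, so that it can be rewritten inside [posdef_sol]
    and inside the notions of extremal solution. *)
Lemma eq_bE A : eq_b A = nme (mx_complex (lozengemx A)).
Proof.
apply/funext => W; apply/propext; rewrite /eq_b /nme map_trmx mx_complex_real.
by split.
Qed.

Lemma heart_le X Y : loewner_le (heart X) (heart Y) <-> loewner_le X Y.
Proof.
rewrite !heart_diag; apply: iff_trans (loewner_unitary (@jbasis_unitary R n) _ _) _.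
by rewrite /loewner_le -conjdiagB; exact: psd_conjdiag.
Qed.

Lemma heart_sol A X : posdef_sol (eq_b A) (heart X) <-> posdef_sol (eq_a A) X.
Proof.
rewrite eq_bE lozenge_anti heart_diag.
apply: iff_trans (nme_unitaryE _ _ (@jbasis_unitary R n)) _.
split=> [[/posdef_conjdiag pX eX]|[pX eX]]; split=> //.
- exact/nme_conjdiag/eX/posdef_unit.
- exact/posdef_conjdiag.
- exact/nme_conjdiag/eX/posdef_unit.
Qed.

(** Preserved because the coefficient is real. *)
Lemma eq_b_conj A W : posdef_sol (eq_b A) W -> posdef_sol (eq_b A) (conjmat W).
Proof. by rewrite eq_bE -{2}mx_complex_real; exact: nme_conj. Qed.

(** Preserved because [jflip] negates the coefficient, whose sign does not
    affect the equation. *)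
Lemma eq_b_flip A W :
  posdef_sol (eq_b A) W -> posdef_sol (eq_b A) (jflip *m W *m jflip).
Proof.
rewrite eq_bE => /(nme_unitary (@jflip_unitary R n)).
by rewrite jflip_adj lozenge_flip => -[pW /nmeN].
Qed.

Lemma jflip_le (V W : 'M[C]_(n + n)) :
  loewner_le V W -> loewner_le (jflip *m V *m jflip) (jflip *m W *m jflip).
Proof. by rewrite -{1 3}jflip_adj; exact: loewner_congr. Qed.

Lemma jflipK (W : 'M[C]_(n + n)) : jflip *m (jflip *m W *m jflip) *m jflip = W.
Proof. exact/sandwichK/jflip_sqr. Qed.

(** The maximal solution is fixed by both symmetries, so it represents some [X],
    and [heart] embeds the solutions of (a) in order into those of (b). *)
Lemma maximal_heart A W : maximal_posdef_sol (eq_b A) W ->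
  exists2 X, W = heart X & maximal_posdef_sol (eq_a A) X.
Proof.
move=> maxW.
have cW := maximal_invariant (@map_mxCK _ _ _) (@conj_loewner _ _) (@eq_b_conj A) maxW.
have fW := maximal_invariant jflipK jflip_le (@eq_b_flip A) maxW.
have [X eW] := heart_of_invariant cW fW; exists X => //.
move: maxW; rewrite eW => -[/heart_sol sX maxX]; split=> // Y /heart_sol/maxX.
by move/heart_le.
Qed.

Lemma minimal_heart A W : minimal_posdef_sol (eq_b A) W ->
  exists2 X, W = heart X & minimal_posdef_sol (eq_a A) X.
Proof.
move=> minW.
have cW := minimal_invariant (@map_mxCK _ _ _) (@conj_loewner _ _) (@eq_b_conj A) minW.
have fW := minimal_invariant jflipK jflip_le (@eq_b_flip A) minW.
have [X eW] := heart_of_invariant cW fW; exists X => //.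
move: minW; rewrite eW => -[/heart_sol sX minX]; split=> // Y /heart_sol/minX.
by move/heart_le.
Qed.

Lemma heart_compress X : X = 2^-1 *: ((jcolmx n)^t* *m heart X *m jcolmx n).
Proof.
rewrite heart_diag jbasis_congr /jcolmx tr_col_mx map_row_mx !tr_scalar_mx.
rewrite !map_scalar_mx /= rmorph1 conj_ic -scalemxAr -scalemxAl scalerA.
rewrite mul_row_block mul_row_col !(mul_scalar_mx, mul_mx_scalar, scale1r).
have quarter : X = (2^-1 * 2^-1) *: (4 *: X).
  by rewrite scalerA -[LHS]scale1r; congr (_ *: _); field.
have hi := @sqr_ic R; rewrite [LHS]quarter.
by congr (_ *: _); apply/matrixP=> a b; rewrite !mxE; ring: hi.
Qed.

Lemma lozenge_unit A : A \in unitmx -> mx_complex (lozengemx A) \in unitmx.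
Proof.
move=> uA; have uT := @jbasis_unitary R n.
have [uL _] : conjanti A \in unitmx /\ conjanti (invmx (conjmat A)) \in unitmx.
  by apply: mulmx1_unit; rewrite conjantiM mulmxV ?conjdiag1 // map_unitmx.
by rewrite lozenge_anti !unitmx_mul uL map_unitmx unitmx_tr unitarymx_unit.
Qed.
End Correspondence.

(** * The theorem *)

Theorem theorem1 (R : realType) (n : nat) (A : 'M[R[i]]_n) :
  ((exists X : 'M[R[i]]_n, posdef_sol (eq_a A) X) <->
   (exists W : 'M[R[i]]_(n + n), posdef_sol (eq_b A) W)) /\
  ((exists X : 'M[R[i]]_n, posdef_sol (eq_a A) X) ->
   (exists Xp : 'M[R[i]]_n, maximal_posdef_sol (eq_a A) Xp) /\
   (exists Wp : 'M[R[i]]_(n + n), maximal_posdef_sol (eq_b A) Wp) /\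
   (forall (Xp : 'M[R[i]]_n) (Wp : 'M[R[i]]_(n + n)),
      maximal_posdef_sol (eq_a A) Xp ->
      maximal_posdef_sol (eq_b A) Wp ->
      Wp = mx_complex (heartmx Xp) /\
      Xp = 2^-1 *: ((jcolmx n) ^t* *m Wp *m jcolmx n))) /\
  (A \in unitmx ->
   (exists X : 'M[R[i]]_n, posdef_sol (eq_a A) X) ->
   (exists Xm : 'M[R[i]]_n, minimal_posdef_sol (eq_a A) Xm) /\
   (exists Wm : 'M[R[i]]_(n + n), minimal_posdef_sol (eq_b A) Wm) /\
   (forall (Xm : 'M[R[i]]_n) (Wm : 'M[R[i]]_(n + n)),
      minimal_posdef_sol (eq_a A) Xm ->
      minimal_posdef_sol (eq_b A) Wm ->
      Wm = mx_complex (heartmx Xm) /\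
      Xm = 2^-1 *: ((jcolmx n) ^t* *m Wm *m jcolmx n))).
Proof.
have sol_b : (exists X, posdef_sol (eq_a A) X) -> exists W, posdef_sol (eq_b A) W.
  by move=> [X /heart_sol sW]; exists (mx_complex (heartmx X)).
have max_b : (exists W, posdef_sol (eq_b A) W) ->
    exists W, maximal_posdef_sol (eq_b A) W.
  by rewrite eq_bE; exact: nme_maximal.
split; first split=> // /max_b[W /maximal_heart[X _ [sX _]]]; first by exists X.
split=> [/sol_b sW|uA /sol_b sW].
  have [W maxW] := max_b sW; have [X _ maxX] := maximal_heart maxW.
  split; first by exists X.
  split; first by exists W.
  move=> Xp Wp maxXp /maximal_heart[X' -> maxX'].
  by rewrite (maximal_unique maxXp maxX'); split=> //; exact: heart_compress.
have [W minW] : exists W, minimal_posdef_sol (eq_b A) W.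
  by move: sW; rewrite eq_bE; apply/nme_minimal/lozenge_unit.
have [X _ minX] := minimal_heart minW.
split; first by exists X.
split; first by exists W.
move=> Xm Wm minXm /minimal_heart[X' -> minX'].
by rewrite (minimal_unique minXm minX'); split=> //; exact: heart_compress.
Qed.
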